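(* Let $K$ be a field, $Q$ a finite quiver, $\succ$ a length admissible order on the set $\mathcal B$ of paths of $Q$, and $\mathcal T$ a set of paths of length $2$ in $Q$. Let $\mathfrak r\subseteq\{(t,n): t\in\mathcal T,\ n\in\mathcal N_2(t)\}$ and let $\psi\colon\mathfrak r\to K$ be a function. Then $\mathrm{GrAlg}_\psi(\mathcal T)$ is a subvariety (a subset that is the zero set of polynomials) of $\mathrm{GrAlg}(\mathcal T)$. The subvariety $\mathrm{GrAlg}_\psi(\mathcal T)$ lives in affine space $K^{D'}$, where $D'=\left(\sum_{t\in\mathcal T}|\mathcal N_2(t)|\right)-|\mathfrak r|$ (i.e. forgetting the coordinates $x_{t,n}$ with $(t,n)\in\mathfrak r$, which are constant equal to $\psi((t,n))$, it is an affine variety in $K^{D'}$).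
   Context: $KQ$ is the path algebra, $\mathcal B$ the set of all finite directed paths in $Q$ (vertices are paths of length $0$), $\ell(p)$ the length of a path; paths are written left to right, so a path $p$ from $v$ to $w$ satisfies $vpw=p$. ''Ideal'' means two-sided ideal and $\langle X\rangle$ is the two-sided ideal generated by $X$. A length admissible order is a well-order $\succ$ on $\mathcal B$ such that for $p,q,r,s,t\in\mathcal B$: $p\succ q$ implies $pr\succ qr$ if both are nonzero; $p\succ q$ implies $sp\succ sq$ if both are nonzero; $p=rqt$ implies $p\succeq q$; and $\ell(p)>\ell(q)$ implies $p\succ q$. For nonzero $x=\sum_{p\in\mathcal B}\alpha_p p\in KQ$, $\mathrm{tip}(x)$ is the $\succ$-largest $p$ with $\alpha_p\neq 0$; for $X\subseteq KQ$, $\mathrm{tip}(X)=\{\mathrm{tip}(x): x\in X, x\ne 0\}$ and $\mathrm{nontip}(X)=\mathcal B\setminus \mathrm{tip}(X)$. A nonzero $x$ is uniform if $x=vxw$ for some vertices $v,w$; an element is quadratic if it is a $K$-linear combination of paths of length $2$. An ideal is graded if it is generated by length homogeneous elements. A Gröbner basis of a graded ideal $I$ is a set $\mathcal G\subseteq I$ of length homogeneous uniform elements with $\langle\mathrm{tip}(\mathcal G)\rangle=\langle \mathrm{tip}(I)\rangle$. The reduced Gröbner basis of $I$ is $\{g_t: t\in\mathcal T_I\}$, where $\mathcal T_I$ is the unique minimal set of paths generating $\langle\mathrm{tip}(I)\rangle$ and $g_t\in I$ is the unique element with $t-g_t\in\mathrm{Span}_K(\mathrm{nontip}(I))$. $KQ/I$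 is a strong Koszul algebra (with respect to $I$ and $\succ$) if $I$ has a Gröbner basis with respect to $\succ$ consisting of quadratic elements. Given $\mathcal T$: $\mathcal N=\mathcal B\setminus \mathrm{tip}(\langle\mathcal T\rangle)$ (the paths having no subpath in $\mathcal T$); $\mathcal N_2$ is the set of paths of length $2$ in $\mathcal N$; for $t\in\mathcal T$, $\mathcal N_2(t)$ is the set of $n\in\mathcal N_2$ with $t\succ n$ and $n$ having the same start vertex and the same end vertex as $t$. Put $D=\sum_{t\in\mathcal T}|\mathcal N_2(t)|$ and $\mathcal A=K^D$, with points written $X=(x_{t,n})_{t\in\mathcal T,\,n\in\mathcal N_2(t)}$. For $X\in\mathcal A$, $\mathcal G(X)=\{g_t : t\in\mathcal T\}$ with $g_t=t-\sum_{n\in\mathcal N_2(t)}x_{t,n}n$. $\mathrm{GrAlg}(\mathcal T)=\{X\in\mathcal A : KQ/\langle \mathcal G(X)\rangle$ is a strong Koszul algebra with respect to $\langle\mathcal G(X)\rangle$ and $\succ\}$; a point $X$ of it is identified with the algebra $KQ/\langle\mathcal G(X)\rangle$. $\mathrm{GrAlg}_\psi(\mathcal T)$ is the set of strong Koszul algebras $\Lambda=KQ/I$ (with respect to $I$ and $\succ$) such that the reduced Gröbner basis of $I$ is $\{g_t : t\in\mathcal T\}$ with $g_t=t-\sum_{n\in\mathcal N_2(t)}c_{t,n}n$, $c_{t,n}\in K$, and $c_{t,n}=\psi((t,n))$ for each $(t,n)\in\mathfrak r$. Such an algebra is identified with the point $(c_{t,n})\in\mathcal A$. *)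

(* Defs.v *)
From HB Require Import structures.
From mathcomp Require Import all_boot all_order all_algebra finmap.
From mathcomp Require Import boolp classical_sets wochoice.
From mathcomp Require mpoly.

Set Implicit Arguments.
Unset Strict Implicit.
Unset Printing Implicit Defensive.

Import GRing.Theory.

Local Open Scope ring_scope.
Local Open Scope classical_set_scope.

(** * Affine varieties *)

(* Imported locally: monalg, used below, declares the same notations. *)
Section Varieties.
Import mpoly.
Variables (K : fieldType) (I : finType).

Definition zero_set (S : set {mpoly K[#|I|]}) : set {ffun I -> K} :=
  [set X | forall f, S f -> f.@[fun i => X (enum_val i)] = 0].

Definition affine_variety (Y : set {ffun I -> K}) : Prop :=
  exists S : set {mpoly K[#|I|]}, Y = zero_set S.

Definition subvariety (Y Z : set {ffun I -> K}) : Prop :=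
  [/\ affine_variety Z, affine_variety Y & Y `<=` Z].

End Varieties.

From mathcomp Require Import monalg.

(** * Quivers and paths *)

Record quiver := Quiver {
  vertex : finType;
  arrow : finType;
  src : arrow -> vertex;
  tgt : arrow -> vertex
}.

Fixpoint walk (Q : quiver) (v : vertex Q) (s : seq (arrow Q)) : bool :=
  if s is a :: s' then (src a == v) && walk (tgt a) s' else true.

(* A path is its start vertex together with its arrows, read left to right;
   the start vertex matters only for the paths of length 0. *)
Record qpath (Q : quiver) := QPath {
  qpath_val : vertex Q * seq (arrow Q);
  qpath_walk : walk qpath_val.1 qpath_val.2
}.

HB.instance Definition _ (Q : quiver) := [isSub for @qpath_val Q].
HB.instance Definition _ (Q : quiver) := [Countable of qpath Q by <:].

Section Paths.
Context {Q : quiver}.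
Implicit Types p q r : qpath Q.

Definition pstart p : vertex Q := (val p).1.
Definition pend p : vertex Q := last (pstart p) (map (@tgt Q) (val p).2).
Definition plength p : nat := size (val p).2.

Definition pvertex (v : vertex Q) : qpath Q := @QPath Q (v, [::]) isT.

Lemma walk_cat (v : vertex Q) (s1 s2 : seq (arrow Q)) :
  walk v (s1 ++ s2) = walk v s1 && walk (last v (map (@tgt Q) s1)) s2.
Proof. by elim: s1 v => //= a s1 IHs v; rewrite IHs andbA. Qed.

(* [None] stands for the product 0 of two paths that do not compose. *)
Definition pmul p q : option (qpath Q) :=
  if pend p == pstart q then insub (pstart p, (val p).2 ++ (val q).2) else None.

Lemma pmulP p q r :
  pmul p q = Some r <->
  pend p = pstart q /\ val r = (pstart p, (val p).2 ++ (val q).2).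
Proof.
rewrite /pmul; split=> [|[-> Er]].
  by case: eqP => // e; case: insubP => // u _ <- [<-].
by rewrite eqxx -Er valK.
Qed.

Lemma pmul_some p q : pend p = pstart q -> exists r, pmul p q = Some r.
Proof.
move=> e; have w : walk (pstart p) ((val p).2 ++ (val q).2).
  by rewrite walk_cat (qpath_walk p) -/(pend p) e (qpath_walk q).
by exists (@QPath Q (pstart p, (val p).2 ++ (val q).2) w); apply/pmulP.
Qed.

Lemma pmul_none p q : pend p <> pstart q -> pmul p q = None.
Proof. by rewrite /pmul => /eqP/negPf ->. Qed.

Lemma pmul_start p q r : pmul p q = Some r -> pstart r = pstart p.
Proof. by case/pmulP => _ E; rewrite /pstart E. Qed.

Lemma pmul_end p q r : pmul p q = Some r -> pend r = pend q.
Proof.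
case/pmulP=> e E; rewrite /pend /pstart E /=.
by rewrite map_cat last_cat -/(pend p) e.
Qed.

Lemma pmulA p q r : obind (pmul p) (pmul q r) = obind (pmul^~ r) (pmul p q).
Proof.
have [epq|npq] := pselect (pend p = pstart q); last first.
  rewrite (pmul_none npq); case E: pmul => [s|] //=.
  by rewrite pmul_none // (pmul_start E).
have [s Es] := pmul_some epq; rewrite Es /=.
have [eqr|nqr] := pselect (pend q = pstart r); last first.
  by rewrite (pmul_none nqr) pmul_none // (pmul_end Es).
have [u Eu] := pmul_some eqr; rewrite Eu /=.
have [x Ex] : exists x, pmul p u = Some x.
  by apply: pmul_some; rewrite (pmul_start Eu).
rewrite Ex; symmetry; apply/pmulP; split; first by rewrite (pmul_end Es).
have [_ ->] := (pmulP _ _ _).1 Ex; have [_ ->] := (pmulP _ _ _).1 Eu.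
by rewrite /pstart; have [_ ->] := (pmulP _ _ _).1 Es; rewrite /= catA.
Qed.

Lemma pmul_vertex_l (v : vertex Q) p :
  pmul (pvertex v) p = if v == pstart p then Some p else None.
Proof.
case: eqP => [e|ne]; last exact: pmul_none.
by apply/pmulP; split=> //; rewrite /= [pstart _]e; case: p {e} => -[].
Qed.

Lemma pmul_vertex_r (v : vertex Q) p :
  pmul p (pvertex v) = if pend p == v then Some p else None.
Proof.
case: eqP => [e|ne]; last exact: pmul_none.
by apply/pmulP; split=> //; rewrite /= cats0; case: p {e} => -[].
Qed.

End Paths.

(** Paths of a fixed length *)

Definition lpath (Q : quiver) (n : nat) := {p : qpath Q | plength p == n}.

Arguments lpath Q n%_nat_scope.

Section FixedLength.
Variables (Q : quiver) (n : nat).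

HB.instance Definition _ := Countable.on (lpath Q n).

Let code (p : lpath Q n) : vertex Q * n.-tuple (arrow Q) :=
  (pstart (val p), Tuple (valP p)).
Let decode (c : vertex Q * n.-tuple (arrow Q)) : option (lpath Q n) :=
  obind insub (insub (c.1, tval c.2) : option (qpath Q)).

Fact lpath_codeK : pcancel code decode.
Proof.
move=> p; rewrite /decode /=.
have -> : (pstart (val p), (val (val p)).2) = val (val p).
  by rewrite /pstart; case: (val (val p)).
by rewrite valK /= valK.
Qed.

HB.instance Definition _ : isFinite (lpath Q n) := PCanIsFinite lpath_codeK.

End FixedLength.

(** * The path algebra *)

Definition path_algebra (K : fieldType) (Q : quiver) := {malg K[qpath Q]}.

HB.instance Definition _ K Q := GRing.Lmodule.on (path_algebra K Q).

HB.lock Definition pbasis (K : fieldType) (Q : quiver) (p : qpath Q) :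
  path_algebra K Q := << p >>.

Definition pmul_basis (K : fieldType) (Q : quiver) (p q : qpath Q) :
  path_algebra K Q := oapp (@pbasis K Q) 0 (pmul p q).

HB.lock Definition kq_mul (K : fieldType) (Q : quiver) (x y : path_algebra K Q) :
    path_algebra K Q :=
  \sum_(p <- msupp x) \sum_(q <- msupp y) (x@_p * y@_q) *: pmul_basis K p q.

Section PathAlgebra.
Variables (K : fieldType) (Q : quiver).
Local Notation KQ := (path_algebra K Q).
Implicit Types (x y z : KQ) (p q : qpath Q).

Local Notation pbasis := (@pbasis K Q).
Local Notation pmul_basis := (@pmul_basis K Q).
Local Notation kq_mul := (@kq_mul K Q).

Definition kq_one : KQ := \sum_(v : vertex Q) pbasis (pvertex v).

Fact kq_mulEw (d1 d2 : {fset qpath Q}) x y :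
    (msupp x `<=` d1)%fset -> (msupp y `<=` d2)%fset ->
  kq_mul x y = \sum_(p <- d1) \sum_(q <- d2) (x@_p * y@_q) *: pmul_basis p q.
Proof.
move=> s1 s2; rewrite kq_mul.unlock (big_fset_incl _ s1) /=; last first.
  move=> p _ /mcoeff_outdom ->; rewrite big1 // => q _.
  by rewrite mul0r scale0r.
apply: eq_bigr => p _; apply: (big_fset_incl _ s2) => q _ /mcoeff_outdom ->.
by rewrite mulr0 scale0r.
Qed.

Fact kq_mulDl : left_distributive kq_mul +%R.
Proof.
move=> x y z; set d := (msupp x `|` msupp y)%fset.
rewrite (kq_mulEw (d1 := d) (d2 := msupp z)) ?msuppD_le //.
rewrite (kq_mulEw (d1 := d) (d2 := msupp z)) ?fsubsetUl //.
rewrite (kq_mulEw (d1 := d) (d2 := msupp z) (x := y)) ?fsubsetUr //.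
rewrite -big_split; apply: eq_bigr => p _ /=.
rewrite -big_split; apply: eq_bigr => q _ /=.
by rewrite mcoeffD mulrDl scalerDl.
Qed.

Fact kq_mulDr : right_distributive kq_mul +%R.
Proof.
move=> z x y; set d := (msupp x `|` msupp y)%fset.
rewrite (kq_mulEw (d1 := msupp z) (d2 := d)) ?msuppD_le //.
rewrite (kq_mulEw (d1 := msupp z) (d2 := d)) ?fsubsetUl //.
rewrite (kq_mulEw (d1 := msupp z) (d2 := d) (y := y)) ?fsubsetUr //.
rewrite -big_split; apply: eq_bigr => p _ /=.
rewrite -big_split; apply: eq_bigr => q _ /=.
by rewrite mcoeffD mulrDr scalerDl.
Qed.

Fact kq_mulZl (c : K) x y : kq_mul (c *: x) y = c *: kq_mul x y.
Proof.
rewrite (kq_mulEw (d1 := msupp x) (d2 := msupp y)) ?msuppZ_le //.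
rewrite kq_mul.unlock scaler_sumr; apply: eq_bigr => p _.
rewrite scaler_sumr; apply: eq_bigr => q _.
by rewrite mcoeffZ scalerA mulrA.
Qed.

Fact kq_mulZr (c : K) x y : kq_mul x (c *: y) = c *: kq_mul x y.
Proof.
rewrite (kq_mulEw (d1 := msupp x) (d2 := msupp y)) ?msuppZ_le //.
rewrite kq_mul.unlock scaler_sumr; apply: eq_bigr => p _.
rewrite scaler_sumr; apply: eq_bigr => q _.
by rewrite mcoeffZ scalerA mulrCA.
Qed.

Fact kq_mul0x x : kq_mul 0 x = 0.
Proof. by rewrite kq_mul.unlock msupp0 big_seq_fset0. Qed.

Fact kq_mulx0 x : kq_mul x 0 = 0.
Proof. by rewrite kq_mul.unlock big1 // => p _; rewrite msupp0 big_seq_fset0. Qed.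

Fact kq_mul_basis p q : kq_mul (pbasis p) (pbasis q) = pmul_basis p q.
Proof.
rewrite (kq_mulEw (d1 := [fset p]%fset) (d2 := [fset q]%fset)) ?pbasis.unlock ?msuppU_le //.
by rewrite !big_seq_fset1 !mcoeffUU mulr1 scale1r.
Qed.

Fact kq_ind (P : KQ -> Prop) :
  P 0 -> (forall x y, P x -> P y -> P (x + y)) ->
  (forall (c : K) p, P (c *: pbasis p)) -> forall x, P x.
Proof.
move=> P0 PD PZ x; rewrite [x]monalgE.
apply: (big_ind P) => // p _.
have -> : << x@_p *g p >> = x@_p *: pbasis p; last exact: PZ.
rewrite pbasis.unlock; apply/malgP=> k; rewrite mcoeffZ !mcoeffU.
by case: eqP => _; rewrite ?mulr1 ?mulr0.
Qed.

Fact kq_mulA : associative kq_mul.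
Proof.
move=> x y z; move: x; apply: kq_ind => [|x x' e e'|c p].
- by rewrite !kq_mul0x.
- by rewrite !kq_mulDl e e'.
rewrite (kq_mulZl c (pbasis p)) (kq_mulZl c (pbasis p) y) kq_mulZl.
apply: (congr1 ( *:%R c)) => {c}; move: y; apply: kq_ind => [|y y' e e'|c q].
- by rewrite kq_mul0x kq_mulx0 kq_mul0x.
- by rewrite (kq_mulDl y y' z) kq_mulDr e e' (kq_mulDr _ y y') kq_mulDl.
rewrite (kq_mulZl c (pbasis q)) (kq_mulZr c (pbasis p) (pbasis q)).
rewrite kq_mulZr kq_mulZl; apply: (congr1 ( *:%R c)) => {c}; move: z; apply: kq_ind => [|z z' e e'|c r].
- by rewrite !kq_mulx0.
- by rewrite !kq_mulDr e e'.
rewrite (kq_mulZr c (pbasis q)) (kq_mulZr c (pbasis p)) kq_mulZr.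
apply: (congr1 ( *:%R c)) => {c}.
rewrite !kq_mul_basis /pmul_basis; have := pmulA p q r.
case: (pmul q r) (pmul p q) => [s|] [u|] /= E; rewrite ?kq_mul0x ?kq_mulx0 //.
- by rewrite !kq_mul_basis /pmul_basis E.
- by rewrite kq_mul_basis /pmul_basis E.
- by rewrite kq_mul_basis /pmul_basis -E.
Qed.

Fact kq_mul1x : left_id kq_one kq_mul.
Proof.
apply: kq_ind => [|x y e e'|c p]; first exact: kq_mulx0.
  by rewrite kq_mulDr e e'.
rewrite kq_mulZr; apply: (congr1 ( *:%R c)); rewrite /kq_one.
rewrite (big_morph (kq_mul^~ _) (fun x y => kq_mulDl x y _) (kq_mul0x _)).
rewrite (bigD1 (pstart p)) //= big1 => [|v /negPf nv].
  by rewrite addr0 kq_mul_basis /pmul_basis pmul_vertex_l eqxx.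
by rewrite kq_mul_basis /pmul_basis pmul_vertex_l nv.
Qed.

Fact kq_mulx1 : right_id kq_one kq_mul.
Proof.
apply: kq_ind => [|x y e e'|c p]; first exact: kq_mul0x.
  by rewrite kq_mulDl e e'.
rewrite kq_mulZl; apply: (congr1 ( *:%R c)); rewrite /kq_one.
rewrite (big_morph (kq_mul _) (kq_mulDr _) (kq_mulx0 _)).
rewrite (bigD1 (pend p)) //= big1 => [|v /negPf nv].
  by rewrite addr0 kq_mul_basis /pmul_basis pmul_vertex_r eqxx.
by rewrite kq_mul_basis /pmul_basis pmul_vertex_r eq_sym nv.
Qed.

(* A pzRingType only, since a quiver without vertices has path algebra 0; this
   rules out the library's algType, which kq_mulZl and kq_mulZr stand in for. *)
HB.instance Definition _ := GRing.Zmodule_isPzRing.Build KQ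
  kq_mulA kq_mul1x kq_mulx1 kq_mulDl kq_mulDr.

End PathAlgebra.

(** * Ideals *)

Definition two_sided_ideal (R : pzRingType) (I : set R) : Prop :=
  [/\ I 0, forall x y, I x -> I y -> I (x + y)
    & forall a x b, I x -> I (a * x * b)].

Definition ideal_gen (R : pzRingType) (X : set R) : set R :=
  smallest (@two_sided_ideal R) X.

(** * Length admissible orders *)

(* [le p q] is the non-strict comparison of p and q, with q the larger;
   [gt le] is the associated strict order, written with a succ sign in the
   literature. *)
Definition gt (Q : quiver) (le : rel (qpath Q)) : rel (qpath Q) :=
  fun p q => (p != q) && le q p.

Definition length_admissible (Q : quiver) (le : rel (qpath Q)) : Prop :=
  [/\ wochoice.well_order le,
      forall p q r pr qr, pmul p r = Some pr -> pmul q r = Some qr ->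
        gt le p q -> gt le pr qr,
      forall p q s sp sq, pmul s p = Some sp -> pmul s q = Some sq ->
        gt le p q -> gt le sp sq,
      forall p q r t, obind (pmul^~ t) (pmul r q) = Some p -> le q p
    & forall p q, (plength q < plength p)%N -> gt le p q].

(** * Tips, Groebner bases and strong Koszul algebras *)

Section Groebner.
Variables (K : fieldType) (Q : quiver) (le : rel (qpath Q)).
Local Notation KQ := (path_algebra K Q).
Implicit Types (x g : KQ) (p : qpath Q) (I G : set KQ) (P : set (qpath Q)).

Definition is_tip x p : Prop :=
  p \in msupp x /\ forall q, q \in msupp x -> le q p.

Definition tips (X : set KQ) : set (qpath Q) :=
  [set p | exists2 x, X x & x != 0 /\ is_tip x p].

Definition nontips (X : set KQ) : set (qpath Q) := ~` tips X.

Definition path_ideal P : set KQ := ideal_gen (@pbasis K Q @` P).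

Definition path_span P : set KQ := [set x | forall p, p \in msupp x -> P p].

Definition uniform x : Prop :=
  x != 0 /\
  exists v w, x = pbasis K (pvertex v) * x * pbasis K (pvertex w).

Definition homogeneous x : Prop :=
  exists n, path_span [set p | plength p = n] x.

Definition quadratic x : Prop := path_span [set p | plength p = 2%N] x.

Definition graded_ideal I : Prop :=
  two_sided_ideal I /\
  exists2 X : set KQ, X `<=` homogeneous & I = ideal_gen X.

Definition groebner_basis I G : Prop :=
  [/\ graded_ideal I, G `<=` I,
      forall g, G g -> homogeneous g /\ uniform g
    & path_ideal (tips G) = path_ideal (tips I)].

(* A property of the presentation KQ/I, hence of the pair (I, le). *)
Definition strong_koszul I : Prop :=
  exists2 G : set KQ, groebner_basis I G & G `<=` quadratic.

Definition minimal_tips I P : Prop :=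
  path_ideal P = path_ideal (tips I) /\
  forall P', P' `<=` P -> path_ideal P' = path_ideal (tips I) -> P' = P.

Definition reduced_groebner_basis I G : Prop :=
  exists2 P, minimal_tips I P &
    G = [set g | exists2 t, P t & I g /\ path_span (nontips I) (pbasis K t - g)].

End Groebner.

(** * The varieties *)

Section GrAlg.
Variables (K : fieldType) (Q : quiver) (le : rel (qpath Q)).
Variable T : {set lpath Q 2}.
Local Notation KQ := (path_algebra K Q).

Definition normal_paths : set (qpath Q) :=
  nontips le (path_ideal [set val t | t in [set` T]] : set KQ).

Definition N2 : {set lpath Q 2} :=
  finset (fun n : lpath Q 2 => `[< normal_paths (val n) >]).

Definition N2of (t : lpath Q 2) : {set lpath Q 2} :=
  finset (fun n : lpath Q 2 => [&& n \in N2, gt le (val t) (val n),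
    pstart (val n) == pstart (val t) & pend (val n) == pend (val t)]).

(* The index set of the coordinates x_(t, n); points of the affine space are
   elements of {ffun var_index -> K}. *)
Definition var_index : finType :=
  {tn : lpath Q 2 * lpath Q 2 | (tn.1 \in T) && (tn.2 \in N2of tn.1)}.

Lemma card_var_index : #|var_index| = (\sum_(t in T) #|N2of t|)%N.
Proof.
rewrite card_sig -sum1_card.
rewrite (eq_bigl (fun tn => (tn.1 \in T) && (tn.2 \in N2of tn.1))) //.
rewrite -(pair_big_dep (mem T) (fun t n => n \in N2of t) (fun _ _ => 1%N)) /=.
by apply: eq_bigr => t _; rewrite sum1_card.
Qed.

Definition gelt (X : {ffun var_index -> K}) (t : lpath Q 2) : KQ :=
  pbasis K (val t) -
  \sum_(c : var_index | (val c).1 == t) X c *: pbasis K (val (val c).2).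

Definition gset (X : {ffun var_index -> K}) : set KQ :=
  [set gelt X t | t in [set` T]].

Definition GrAlg : set {ffun var_index -> K} :=
  [set X | strong_koszul le (ideal_gen (gset X))].

Definition GrAlg_psi (r : {set var_index}) (psi : {c : var_index | c \in r} -> K) :
    set {ffun var_index -> K} :=
  [set X | exists I : set KQ,
     [/\ strong_koszul le I, reduced_groebner_basis le I (gset X)
       & forall c : {c : var_index | c \in r}, X (val c) = psi c]].

Definition free_index (r : {set var_index}) : finType := {c : var_index | c \notin r}.

Definition forget (r : {set var_index}) (X : {ffun var_index -> K}) :
    {ffun free_index r -> K} := [ffun c => X (val c)].

End GrAlg.

(* Main.v *)
Require Import Defs.
From mathcomp Require Import all_boot all_order all_algebra finmap.
From mathcomp Require Import boolp classical_sets wochoice.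
From mathcomp Require mpoly.

(** For a point X write I(X) for the ideal generated by the elements g_t, and
    call a path reducible when it has a subpath in T.  Since t is the tip of
    g_t, every reducible path is a tip of I(X).  Conversely, in degree 2 the
    ideal I(X) is just the span of the g_t, so its quadratic elements have
    their tips in T; a quadratic Groebner basis therefore forces every tip of
    I(X) to be reducible.  Hence X lies in GrAlg(T) exactly when the tips of
    I(X) are the reducible paths and nothing more (GrAlg_tipsP).

    This is a condition on ranks.  The degree n part of I(X) is spanned by the
    finitely many elements a g_t b with a t b of length n, that is, by the rows
    of a matrix whose columns are the paths of length n and whose entries are
    polynomials in X.  The rank of a matrix with totally ordered columns is the
    number of columns at which some vector of its row space leads (rank_leads),
    so here it is the number of tips of I(X) of length n.  This number is
    always at least the number of reducible paths of length n, and X lies in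
    GrAlg(T) exactly when it is at most that number for every n: all the larger
    minors have to vanish.  These minors are polynomials in X, so GrAlg(T) is
    affine.

    The set GrAlg_psi(T) is cut out of GrAlg(T) by the equations
    x_(t, n) = psi(t, n) (GrAlg_psiE).  For this one has to know that an ideal I
    with reduced Groebner basis G(X) is I(X), which follows from the principle
    that two nested subspaces with the same tips are equal
    (subspace_tips_sub), and that for X in GrAlg(T) the set G(X) is indeed the
    reduced Groebner basis of I(X).  Finally, forgetting the fixed coordinates
    turns GrAlg_psi(T) into the preimage of GrAlg(T) under the map that puts the
    constants psi(t, n) back, and preimages of affine varieties under
    polynomial maps are affine. *)

Set Implicit Arguments.
Unset Strict Implicit.
Unset Printing Implicit Defensive.

Local Open Scope classical_set_scope.

(** * Polynomial functions and affine varieties *)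

Section PolynomialFunctions.
Import GRing.Theory mpoly.
Local Open Scope ring_scope.
Variable K : fieldType.

(** Working with functions instead of polynomials avoids all bookkeeping on
    the numbering of the variables. *)
Definition poly_fun (I : finType) (F : {ffun I -> K} -> K) : Prop :=
  exists f : {mpoly K[#|I|]}, forall X, F X = f.@[fun i => X (enum_val i)].

Section Closure.
Variable I : finType.
Implicit Types F G : {ffun I -> K} -> K.

Lemma poly_fun_const c : poly_fun (fun _ : {ffun I -> K} => c).
Proof. by exists c%:MP => X; rewrite mevalC. Qed.

Lemma poly_fun_coord c : poly_fun (fun X : {ffun I -> K} => X c).
Proof. by exists 'X_(enum_rank c) => X; rewrite mevalXU enum_rankK. Qed.

Lemma poly_funD F G :
  poly_fun F -> poly_fun G -> poly_fun (fun X => F X + G X).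
Proof. by move=> [f Ef] [g Eg]; exists (f + g) => X; rewrite mevalD Ef Eg. Qed.

Lemma poly_funM F G :
  poly_fun F -> poly_fun G -> poly_fun (fun X => F X * G X).
Proof. by move=> [f Ef] [g Eg]; exists (f * g) => X; rewrite mevalM Ef Eg. Qed.

Lemma poly_funN F : poly_fun F -> poly_fun (fun X => - F X).
Proof. by move=> [f Ef]; exists (- f) => X; rewrite mevalN Ef. Qed.

Lemma poly_fun_sum (J : Type) (s : seq J) (P : pred J)
    (F : J -> {ffun I -> K} -> K) :
    (forall j, poly_fun (F j)) -> poly_fun (fun X => \sum_(j <- s | P j) F j X).
Proof.
move=> pF; elim: s => [|j s IHs].
  by exists 0 => X; rewrite big_nil meval0.
case Pj: (P j); last by case: IHs => f Ef; exists f => X; rewrite big_cons Pj.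
have [f Ef] := poly_funD (pF j) IHs.
by exists f => X; rewrite big_cons Pj -Ef.
Qed.

Lemma poly_fun_prod (J : Type) (s : seq J) (P : pred J)
    (F : J -> {ffun I -> K} -> K) :
    (forall j, poly_fun (F j)) -> poly_fun (fun X => \prod_(j <- s | P j) F j X).
Proof.
move=> pF; elim: s => [|j s IHs].
  by exists 1 => X; rewrite big_nil meval1.
case Pj: (P j); last by case: IHs => f Ef; exists f => X; rewrite big_cons Pj.
have [f Ef] := poly_funM (pF j) IHs.
by exists f => X; rewrite big_cons Pj -Ef.
Qed.

(** The Leibniz formula writes a determinant as a sum of products of entries. *)
Lemma poly_fun_det n (A : {ffun I -> K} -> 'M[K]_n) :
  (forall i j, poly_fun (fun X => A X i j)) -> poly_fun (fun X => \det (A X)).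
Proof.
move=> pA; apply: poly_fun_sum => s; apply: poly_funM.
  exact: poly_fun_const.
by apply: poly_fun_prod => i.
Qed.

End Closure.

Lemma poly_fun_comp (I J : finType) (phi : {ffun J -> K} -> {ffun I -> K})
    (F : {ffun I -> K} -> K) :
  (forall c, poly_fun (fun Z => phi Z c)) -> poly_fun F ->
  poly_fun (F \o phi).
Proof.
move=> /choice[h Eh] [f Ef].
exists (f \mPo [tuple h (enum_val i) | i < #|I|]) => Z /=.
rewrite Ef comp_mpoly_meval; apply: meval_eq => i.
by rewrite tnth_mktuple Eh.
Qed.

Lemma affine_varietyP (I : finType) (Y : set {ffun I -> K}) :
  affine_variety Y <->
  exists S : set ({ffun I -> K} -> K),
    S `<=` @poly_fun I /\ forall X, Y X <-> forall F, S F -> F X = 0.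
Proof.
split=> [[S ->]|[S [pS YS]]].
  exists [set F : {ffun I -> K} -> K |
    exists2 f, S f & forall X, F X = f.@[fun i => X (enum_val i)]].
  split=> [F [f _ Ef]|X]; first by exists f.
  split=> [SX F [f /SX fX ->//]|SX f Sf].
  by apply: (SX (fun X => f.@[fun i => X (enum_val i)])); exists f.
exists [set f : {mpoly K[#|I|]} |
  exists2 F, S F & forall X, F X = f.@[fun i => X (enum_val i)]].
apply/seteqP; split=> X /=; first by move/YS => SX f [F SF <-]; apply: SX.
move=> SX; apply/YS => F SF; have [f Ef] := pS F SF.
by rewrite Ef; apply: SX; exists F.
Qed.

Lemma affine_variety_preimage (I J : finType)
    (phi : {ffun J -> K} -> {ffun I -> K}) (Y : set {ffun I -> K}) :
  (forall c, poly_fun (fun Z => phi Z c)) -> affine_variety Y ->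
  affine_variety (phi @^-1` Y).
Proof.
move=> pphi /affine_varietyP[S [pS YS]]; apply/affine_varietyP.
exists [set F \o phi | F in S]; split=> [_ [F SF <-]|Z].
  by apply: poly_fun_comp => //; apply: pS.
split=> [/YS SX _ [F SF <-]|SZ]; first exact: SX.
by apply/YS => F SF; apply: (SZ (F \o phi)); exists F.
Qed.

Lemma affine_varietyI (I : finType) (Y Z : set {ffun I -> K}) :
  affine_variety Y -> affine_variety Z -> affine_variety (Y `&` Z).
Proof.
move=> /affine_varietyP[S [pS YS]] /affine_varietyP[S' [pS' ZS']].
apply/affine_varietyP; exists (S `|` S'); split=> [F [/pS|/pS']//|X].
split=> [[/YS SX /ZS' SX'] F [/SX|/SX']//|SX].
by split; [apply/YS|apply/ZS'] => F SF; apply: SX; [left|right].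
Qed.

End PolynomialFunctions.

(** * Ranks, minors and leading columns *)

Lemma total_order_max (T : eqType) (R : rel T) (I : finType) (P : pred I)
    (F : I -> T) (i0 : I) :
  total_order R -> P i0 ->
  exists2 i, P i & forall j, P j -> R (F j) (F i).
Proof.
move=> [[[R_refl R_trans] _] R_total] Pi0.
have [] := @extremumP _ _ (fun x y => R y x) i0 P F R_refl _ _ Pi0.
- by move=> y x z yx zy; apply: R_trans zy yx.
- by move=> x y; apply: R_total.
by move=> i Pi ubi; exists i.
Qed.

Section Ranks.
Import GRing.Theory.
Local Open Scope ring_scope.
Variable K : fieldType.

(** A matrix of rank k contains an invertible k by k submatrix: keep a maximal
    free family of rows, then a maximal free family of columns. *)
Lemma rank_le_minors m n (A : 'M[K]_(m, n)) d :
  (\rank A <= d)%N <->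
  forall k (f : 'I_k -> 'I_m) (g : 'I_k -> 'I_n),
    (d < k)%N -> \det (mxsub f g A) = 0.
Proof.
split=> [rA k f g ltdk|minors].
  apply/eqP; apply: contraTT ltdk => nz; rewrite -leqNgt (leq_trans _ rA) //.
  have <- : \rank (mxsub f g A) = k.
    by apply/mxrank_unit; rewrite unitmxE unitfE.
  rewrite mxsubrc; apply: leq_trans (mxrankS (rowsub_sub _ _)) _.
  by rewrite -mxrank_tr trmx_mxsub -[leqRHS]mxrank_tr mxrankS ?rowsub_sub.
rewrite leqNgt; apply/negP => /minors dA.
set B := rowsub (maxrankfun A) A.
have fB : row_full B^T by rewrite /row_full mxrank_tr (eqP (maxrowsub_free A)).
have := fullrowsub_unit fB; rewrite unitmxE unitfE -det_tr trmx_mxsub trmxK.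
by rewrite -mxsub_comp dA eqxx.
Qed.

Section Leads.
Variables (m n : nat) (A : 'M[K]_(m, n)) (le : rel 'I_n).
Hypothesis le_total : total_order le.

(** The analogue for row vectors of the tip of an element of KQ. *)
Definition leads (v : 'rV[K]_n) (j : 'I_n) : Prop :=
  v 0 j != 0 /\ forall k, v 0 k != 0 -> le k j.

Lemma leads_exists (v : 'rV[K]_n) : v != 0 -> exists j, leads v j.
Proof.
case/rV0Pn => j vj.
have [k vk ubk] := total_order_max (P := fun j => v 0 j != 0) id le_total vj.
by exists k.
Qed.

(** With a row space of dimension larger than the number of leading columns,
    some nonzero vector of the row space would vanish on all of these columns,
    and could not lead anywhere.  Conversely, vectors with distinct leading
    columns are linearly independent: in a combination of them, the largest
    leading column cannot cancel. *)
Lemma rank_leads :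
  \rank A = #|[pred j | `[< exists2 v : 'rV[K]_n, (v <= A)%MS & leads v j >]]|.
Proof.
have [[_ le_anti] _] := le_total.
set S := [pred j | _]; apply/eqP; rewrite eqn_leq; apply/andP; split.
  rewrite leqNgt; apply/negP => ltSA.
  pose C := colsub (enum_val : 'I_#|S| -> 'I_n) (row_base A).
  have /rowV0Pn[u uC nzu] : kermx C != 0.
    by rewrite kermx_eq0 /row_free neq_ltn (leq_ltn_trans (rank_leq_col _) ltSA).
  pose v := u *m row_base A.
  have vA : (v <= A)%MS by rewrite (submx_trans (submxMl _ _)) ?eq_row_base.
  have nzv : v != 0.
    by rewrite mulmx_free_eq0 ?row_base_free.
  have [j vj] := leads_exists nzv.
  have Sj : j \in S by rewrite inE; exists v.
  case: vj => nzvj _; case/negP: nzvj.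
  move: uC => /sub_kermxP/rowP/(_ (enum_rank_in Sj j)).
  rewrite /v !mxE => uC0; rewrite -[X in _ == X]uC0; apply/eqP.
  by apply: eq_bigr => i _; rewrite [C _ _]mxE enum_rankK_in.
have /choice[f fP] (j : 'I_#|S|) : exists v : 'rV[K]_n,
    (v <= A)%MS /\ leads v (enum_val j).
  by have := enum_valP j; rewrite inE => -[v]; exists v.
pose B := \matrix_j f j.
suff fB : row_free B.
  rewrite -(eqP fB) mxrankS //; apply/row_subP => j; rewrite rowK.
  by case: (fP j).
rewrite -kermx_eq0; apply/rowV0P => u /sub_kermxP uB.
apply/eqP; apply: contraT => /rV0Pn[j0 uj0].
(* the j for which the leading column of f j is largest, where u is nonzero *)
have [j uj ubj] :=
  total_order_max (P := fun j => u 0 j != 0) enum_val le_total uj0.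
move: uB => /rowP/(_ (enum_val j)); rewrite !mxE (bigD1 j) //= big1 => [|k neqkj].
  rewrite addr0 mxE => /eqP; rewrite mulf_eq0 (negPf uj) /=.
  by have [_ []] := fP j; case: eqP.
have [->|uk] := eqVneq (u 0 k) 0; first by rewrite mul0r.
rewrite mxE; have [->|fkj] := eqVneq (f k 0 (enum_val j)) 0.
  by rewrite mulr0.
have [_ [_ /(_ _ fkj) lejk]] := fP k.
have /enum_val_inj ekj : enum_val k = enum_val j.
  by apply: le_anti; rewrite lejk ubj.
by rewrite ekj eqxx in neqkj.
Qed.

End Leads.

End Ranks.

From mathcomp Require Import monalg.

(** * Products of three paths, and subpaths *)

Section Sandwich.
Variable Q : quiver.
Implicit Types a b p q w : qpath Q.

Definition sandwich a p b : option (qpath Q) := obind (pmul^~ b) (pmul a p).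

Lemma sandwichP a p b w :
  sandwich a p b = Some w <->
  [/\ pend a = pstart p, pend p = pstart b
    & val w = (pstart a, (val a).2 ++ (val p).2 ++ (val b).2)].
Proof.
rewrite /sandwich; split=> [|[eap epb Ew]].
  case Eap: (pmul a p) => [u|] //= /pmulP[eub Ew].
  rewrite -(pmul_end Eap) Ew (pmul_start Eap).
  by have [-> ->] := (pmulP _ _ _).1 Eap; rewrite -catA.
have [u Eu] := pmul_some eap; rewrite Eu /=; apply/pmulP.
rewrite (pmul_end Eu) (pmul_start Eu) epb; split=> //.
by rewrite Ew; have [_ ->] := (pmulP _ _ _).1 Eu; rewrite -catA.
Qed.

Lemma qpath_eq p q : pstart p = pstart q -> (val p).2 = (val q).2 -> p = q.
Proof.
case: p q => [[v s] ws] [[v' s'] ws']; rewrite /pstart /= => ev es.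
by apply: val_inj; rewrite /= ev es.
Qed.

(** Paths can be cancelled on both sides, so multiplication by a on the left and
    b on the right merely relabels the coefficients of an element. *)
Lemma sandwich_inj a p q b w :
  sandwich a p b = Some w -> sandwich a q b = Some w -> p = q.
Proof.
move=> /sandwichP[ep _ Ep] /sandwichP[eq _]; rewrite Ep => -[/eqP].
rewrite eqseq_cat // eqxx /= => /eqP.
move/(congr1 rev); rewrite !rev_cat => /eqP; rewrite eqseq_cat // eqxx /=.
move/eqP/(can_inj revK) => e2; apply: qpath_eq => //.
by rewrite -ep.
Qed.

Lemma sandwich_start a p b w : sandwich a p b = Some w -> pstart w = pstart a.
Proof. by move=> /sandwichP[_ _ E]; rewrite -[pstart w]/((val w).1) E. Qed.

Lemma sandwich_end a p b w : sandwich a p b = Some w -> pend w = pend b.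
Proof.
rewrite /sandwich; case: (pmul a p) => [u|] //=; exact: pmul_end.
Qed.

Lemma sandwich_length a p b w :
  sandwich a p b = Some w -> plength w = (plength a + plength p + plength b)%N.
Proof. by move=> /sandwichP[_ _ E]; rewrite /plength E !size_cat addnA. Qed.

Lemma sandwich_vertices p :
  sandwich (pvertex (pstart p)) p (pvertex (pend p)) = Some p.
Proof. by rewrite /sandwich pmul_vertex_l eqxx /= pmul_vertex_r eqxx. Qed.

Lemma sandwich_comp a p b c d w u :
  sandwich a p b = Some w -> sandwich c w d = Some u ->
  exists a' b', sandwich a' p b' = Some u.
Proof.
move=> Ew Eu; have /sandwichP[ecw ewd Eu'] := Eu.
have /sandwichP[eap epb Ew'] := Ew.
have [a' Ea] : exists a', pmul c a = Some a'.
  by apply: pmul_some; rewrite ecw (sandwich_start Ew).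
have [b' Eb] : exists b', pmul b d = Some b'.
  by apply: pmul_some; rewrite -ewd (sandwich_end Ew).
exists a', b'; apply/sandwichP; rewrite (pmul_end Ea) (pmul_start Eb).
split=> //; rewrite Eu' Ew' /= (pmul_start Ea).
have [_ ->] := (pmulP _ _ _).1 Ea; have [_ ->] := (pmulP _ _ _).1 Eb.
by rewrite /= !catA.
Qed.

Definition multiples (P : set (qpath Q)) : set (qpath Q) :=
  [set w | exists a p b, P p /\ sandwich a p b = Some w].

Lemma sub_multiples P : P `<=` multiples P.
Proof.
move=> p Pp; exists (pvertex (pstart p)), p, (pvertex (pend p)).
by rewrite sandwich_vertices.
Qed.

(** Between paths of equal length, being a subpath means being equal. *)
Lemma multiples_lpath n (P : set (qpath Q)) p :
  (forall q, P q -> plength q = n) -> plength p = n -> multiples P p -> P p.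
Proof.
move=> Pn pn [a [q [b [Pq E]]]].
have := sandwich_length E; rewrite pn (Pn q Pq).
move=> /eqP; rewrite -[X in X == _]addn0 addnAC addnC eqn_add2r eq_sym addn_eq0.
case/andP=> /nilP a0 /nilP b0; suff <- : q = p by [].
have /sandwichP[eaq _ Ep] := E; rewrite a0 b0 cats0 in Ep.
have {}eaq : pstart a = pstart q by rewrite -eaq /pend a0.
by apply: qpath_eq; rewrite -?eaq -?[pstart p]/((val p).1) Ep.
Qed.

End Sandwich.

(** * Subspaces and ideals of the path algebra *)

Section PathAlgebra.
Import GRing.Theory.
Local Open Scope ring_scope.
Variables (K : fieldType) (Q : quiver).
Local Notation KQ := (path_algebra K Q).
Local Notation pb := (@pbasis K Q).
Implicit Types (x y z : KQ) (a b p q w : qpath Q) (I W X : set KQ).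

Lemma mcoeff_pbasis p w : (pb p : KQ)@_w = (p == w)%:R.
Proof. by rewrite pbasis.unlock mcoeffU. Qed.

Lemma msupp_pbasis p w : (w \in msupp (pb p : KQ)) = (w == p).
Proof. by rewrite pbasis.unlock msuppU oner_eq0 in_fset1. Qed.

Lemma kq_scalerAl (c : K) x y : (c *: x) * y = c *: (x * y).
Proof. exact: kq_mulZl. Qed.

Lemma kq_scalerAr (c : K) x y : x * (c *: y) = c *: (x * y).
Proof. exact: kq_mulZr. Qed.

Lemma sandwich_pbasis a p b :
  pb a * pb p * pb b = oapp pb 0 (sandwich a p b).
Proof.
rewrite -[pb a * pb p]/(kq_mul _ _) kq_mul_basis /pmul_basis /sandwich.
case: (pmul a p) => [u|] /=; last by rewrite mul0r.
by rewrite -[LHS]/(kq_mul _ _) kq_mul_basis.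
Qed.

Lemma mcoeff_sandwich a p b w x :
  sandwich a p b = Some w -> (pb a * x * pb b)@_w = x@_p.
Proof.
move=> E; move: x; apply: kq_ind => [|x y Ex Ey|c q].
- by rewrite mulr0 mul0r !mcoeff0.
- by rewrite mulrDr mulrDl !mcoeffD Ex Ey.
rewrite kq_scalerAr kq_scalerAl !mcoeffZ mcoeff_pbasis sandwich_pbasis.
congr (_ * _); have [->|neqp] := eqVneq q p.
  by rewrite E /= mcoeff_pbasis eqxx.
case E': (sandwich a q b) => [u|] /=; last by rewrite mcoeff0.
rewrite mcoeff_pbasis; case: eqP => // euw; case/eqP: neqp.
by apply: sandwich_inj E; rewrite E' euw.
Qed.

Lemma msupp_sandwich a b w x :
  w \in msupp (pb a * x * pb b) ->
  exists2 p, p \in msupp x & sandwich a p b = Some w.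
Proof.
move=> wx; have [[p E]|none] := pselect (exists p, sandwich a p b = Some w).
  by exists p => //; move: wx; rewrite -!mcoeff_neq0 (mcoeff_sandwich _ E).
suff e0 : (pb a * x * pb b)@_w = 0 by rewrite -mcoeff_neq0 e0 eqxx in wx.
move: x {wx}; apply: kq_ind => [|x y Ex Ey|c q].
- by rewrite mulr0 mul0r mcoeff0.
- by rewrite mulrDr mulrDl mcoeffD Ex Ey addr0.
rewrite kq_scalerAr kq_scalerAl mcoeffZ sandwich_pbasis.
case E: (sandwich a q b) => [u|] /=; last by rewrite mcoeff0 mulr0.
rewrite mcoeff_pbasis; case: eqP => [euw|_]; last exact: mulr0.
by case: none; exists q; rewrite E euw.
Qed.

Definition subspace W : Prop :=
  W 0 /\ forall (c : K) x y, W x -> W y -> W (c *: x + y).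

Lemma subspaceD W x y : subspace W -> W x -> W y -> W (x + y).
Proof. by case=> _ /(_ 1 x y); rewrite scale1r. Qed.

Lemma subspaceZ W c x : subspace W -> W x -> W (c *: x).
Proof. by case=> W0 /(_ c x 0) WZ Wx; rewrite -[_ *: _]addr0; apply: WZ. Qed.

Lemma subspaceB W x y : subspace W -> W x -> W y -> W (x - y).
Proof. by move=> sW Wx Wy; rewrite -scaleN1r; apply: subspaceD (subspaceZ _ _ _). Qed.

Lemma subspace_sum W (J : Type) (s : seq J) (P : pred J) (F : J -> KQ) :
  subspace W -> (forall j, P j -> W (F j)) -> W (\sum_(j <- s | P j) F j).
Proof.
move=> sW WF; apply: big_ind => //; first by case: sW.
by move=> x y; apply: subspaceD.
Qed.

Lemma pbasis_expand x : x = \sum_(p <- msupp x) x@_p *: pb p.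
Proof.
rewrite {1}[x]monalgE; apply: eq_bigr => p _.
by apply/malgP => w; rewrite mcoeffZ mcoeffU mcoeff_pbasis mulr_natr.
Qed.

Lemma subspace_pbasis W x :
  subspace W -> (forall p, p \in msupp x -> W (pb p)) -> W x.
Proof.
move=> sW Wp; rewrite [x]pbasis_expand big_seq; apply: subspace_sum => // p px.
by apply: subspaceZ => //; apply: Wp.
Qed.

Lemma path_span_subspace (P : set (qpath Q)) : subspace (path_span P : set KQ).
Proof.
split=> [p|c x y Px Py p]; first by rewrite msupp0.
move/(fsubsetP (msuppD_le _ _)); rewrite in_fsetU.
by case/orP=> [/(fsubsetP (msuppZ_le _ _))|]; auto.
Qed.

Lemma ideal_subspace I : two_sided_ideal I -> subspace I.
Proof.
case=> I0 ID IM; split=> // c x y Ix Iy; apply: ID => //.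
by rewrite -[x]mulr1 -[x]mul1r -!kq_scalerAl; apply: IM.
Qed.

Lemma ideal_gen_ideal (R : pzRingType) (X : set R) : two_sided_ideal (ideal_gen X).
Proof.
split=> [|x y Ix Iy|a x b Ix] J [idJ XJ]; have [J0 JD JM] := idJ.
- exact: J0.
- by apply: JD; [apply: Ix | apply: Iy].
- by apply: JM; apply: Ix.
Qed.

Lemma sub_ideal_gen (R : pzRingType) (X : set R) : X `<=` ideal_gen X.
Proof. by move=> x Xx J [_ XJ]; apply: XJ. Qed.

Lemma ideal_gen_sub (R : pzRingType) (X J : set R) :
  two_sided_ideal J -> X `<=` J -> ideal_gen X `<=` J.
Proof. by move=> idJ XJ x; apply. Qed.

(** As a vector space, the ideal generated by X is spanned by the products a g b
    of elements of X by paths. *)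
Lemma ideal_gen_ind X W :
  subspace W -> (forall a g b, X g -> W (pb a * g * pb b)) -> ideal_gen X `<=` W.
Proof.
move=> sW WX.
(* these x form a two-sided ideal, and 1 is the sum of the vertices *)
suff IW : ideal_gen X `<=` [set x | forall a b, W (pb a * x * pb b)].
  move=> x /IW Wx; rewrite -[x]mulr1 -[x]mul1r.
  rewrite -[1]/(kq_one K Q) /kq_one mulr_suml mulr_sumr; apply: subspace_sum => // v _.
  by rewrite !mulr_suml; apply: subspace_sum => // u _; apply: Wx.
apply: ideal_gen_sub => [|g Xg a b]; last exact: WX.
split=> [a b|x y Wx Wy a b|u x v Wx a b] /=.
- by rewrite mulr0 mul0r; case: sW.
- by rewrite mulrDr mulrDl; apply: subspaceD.
have -> : pb a * (u * x * v) * pb b = (pb a * u) * x * (v * pb b).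
  by rewrite !mulrA.
move: v; apply: kq_ind => [|v v' Wv Wv'|c q].
- by rewrite mul0r mulr0; case: sW.
- by rewrite mulrDl mulrDr; apply: subspaceD.
rewrite kq_scalerAl kq_scalerAr; apply: subspaceZ => //.
rewrite -[pb q * pb b]/(kq_mul _ _) kq_mul_basis /pmul_basis.
case: (pmul q b) => [b'|] /=; last by rewrite mulr0; case: sW.
move: u; apply: kq_ind => [|v v' Wv Wv'|c' p].
- by rewrite mulr0 !mul0r; case: sW.
- by rewrite mulrDr !mulrDl; apply: subspaceD.
rewrite kq_scalerAr !kq_scalerAl; apply: subspaceZ => //.
rewrite -[pb a * pb p]/(kq_mul _ _) kq_mul_basis /pmul_basis.
case: (pmul a p) => [a'|] /=; last by rewrite !mul0r; case: sW.
exact: Wx.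
Qed.

(** The ideals generated by paths are spanned by paths, so that they are
    governed by divisibility alone. *)
Lemma path_idealE (P : set (qpath Q)) :
  (path_ideal P : set KQ) = path_span (multiples P).
Proof.
have sI := ideal_subspace (ideal_gen_ideal (pb @` P)).
apply/seteqP; split.
  apply: ideal_gen_ind (path_span_subspace _) _ => a _ b [p Pp <-] w.
  move=> /msupp_sandwich[q]; rewrite msupp_pbasis => /eqP-> E.
  by exists a, p, b.
move=> x Px; apply: subspace_pbasis => // w /Px[a [p [b [Pp E]]]].
have -> : pb w = pb a * pb p * pb b by rewrite sandwich_pbasis E.
have [_ _ IM] := ideal_gen_ideal (pb @` P).
by apply: IM; apply: sub_ideal_gen; exists p.
Qed.

Lemma pbasis_path_ideal (P : set (qpath Q)) p :
  path_ideal P (pb p) <-> multiples P p.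
Proof.
rewrite path_idealE; split=> [|Pp w]; last by rewrite msupp_pbasis => /eqP->.
by apply; rewrite msupp_pbasis.
Qed.

Lemma path_ideal_inj (P P' : set (qpath Q)) :
  (path_ideal P : set KQ) = path_ideal P' <-> multiples P = multiples P'.
Proof.
split=> [E|E]; last by rewrite !path_idealE E.
by apply/seteqP; split=> p; rewrite -!pbasis_path_ideal E.
Qed.

End PathAlgebra.

(** * Tips of ideals *)

Section Tips.
Import GRing.Theory.
Local Open Scope ring_scope.
Variables (K : fieldType) (Q : quiver) (le : rel (qpath Q)).
Hypothesis hle : length_admissible le.
Local Notation KQ := (path_algebra K Q).
Local Notation pb := (@pbasis K Q).
Implicit Types (x y z : KQ) (a b p q w : qpath Q) (I V W X : set KQ).

(** The three axioms of a total order follow by looking at the least element of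
    sets with two or three elements. *)
Lemma admissible_total_order : total_order le.
Proof.
have [wo _ _ _ _] := hle.
have wo' : @wo_chain (qpath Q) le predT by move=> A _; apply: wo.
have le_total : total le by move=> p q; apply: (wo_chainW wo').
have le_refl : reflexive le by move=> p; apply: (wo_chain_reflexive wo').
have le_anti : antisymmetric le by move=> p q; apply: (wo_chain_antisymmetric wo').
split=> //; split=> //; split=> // q p r lepq leqr.
have [z [[zA zmin] _]] := wo (mem [:: p; q; r]) (ex_intro _ p (mem_head _ _)).
have zp : le z p by apply: zmin; rewrite !inE eqxx.
have zq : le z q by apply: zmin; rewrite !inE eqxx orbT.
have zr : le z r by apply: zmin; rewrite !inE eqxx !orbT.
move: zA; rewrite !inE => /or3P[] /eqP ez; rewrite ez in zp zq zr => //.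
  by rewrite (le_anti p q) // lepq.
by rewrite (le_anti r q) ?zq // in lepq *.
Qed.

Lemma admissible_ind (P : qpath Q -> Prop) :
  (forall p, (forall q, gt le p q -> P q) -> P p) -> forall p, P p.
Proof.
move=> IH p; apply: contrapT => nPp.
have [wo _ _ _ _] := hle.
have [|z [[zA zmin] _]] := wo (fun q => ~~ `[< P q >]).
  by exists p; apply/asboolPn.
have /asboolPn[] := zA; apply: IH => q /andP[neq leqz].
apply: contrapT => /asboolPn nPq; have lezq := zmin q nPq.
have [[_ le_anti] _] := admissible_total_order.
by case/eqP: neq; apply: le_anti; rewrite lezq.
Qed.

Lemma tip_exists x : x != 0 -> exists p, is_tip le x p.
Proof.
move=> nzx; have [p0 p0x] : exists p, p \in msupp x.
  apply: contrapT => none; case/eqP: nzx; apply/malgP => p; rewrite mcoeff0.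
  by apply: mcoeff_outdom; apply/negP => px; apply: none; exists p.
have [p _ ubp] := @total_order_max _ le (msupp x) predT val [` p0x]%fset
  admissible_total_order isT.
exists (val p); split=> [|q qx]; first exact: valP.
exact: (ubp [` qx]%fset).
Qed.

Lemma is_tip_neq0 x p : is_tip le x p -> x != 0.
Proof. by case=> px _; apply: contraTneq px => ->; rewrite msupp0. Qed.

Lemma mem_tips X x p : is_tip le x p -> X x -> tips le X p.
Proof. by move=> tx Xx; exists x => //; split=> //; apply: is_tip_neq0 tx. Qed.

Lemma is_tip_pbasis p : is_tip le (pb p) p.
Proof.
have [[[le_refl _] _] _] := admissible_total_order.
by split=> [|q]; rewrite msupp_pbasis // => /eqP->.
Qed.

Lemma is_tip_sandwich x a p b w :
  is_tip le x p -> sandwich a p b = Some w -> is_tip le (pb a * x * pb b) w.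
Proof.
have [_ mulr mull _ _] := hle.
have [[[le_refl _] _] _] := admissible_total_order.
move=> [px ubp] Ew; split=> [|v].
  by rewrite -mcoeff_neq0 (mcoeff_sandwich _ Ew) mcoeff_neq0.
move=> /msupp_sandwich[q qx Ev]; have [epq|npq] := eqVneq p q.
  by move: Ev; rewrite -epq Ew => -[->].
move: Ev Ew; rewrite /sandwich.
case Eu: (pmul a q) => [u|] //= Ev; case Eu': (pmul a p) => [u'|] //= Ew.
have guu : gt le u' u by apply: mull Eu' Eu _; rewrite /gt npq ubp.
by have /andP[] := mulr _ _ _ _ _ Ew Ev guu.
Qed.

(** Multiplying x by paths multiplies its tip by them, as long as the product of
    the tip with them is nonzero. *)
Lemma multiples_tips I : two_sided_ideal I -> multiples (tips le I) = tips le I.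
Proof.
move=> [_ _ IM]; apply/seteqP; split; last exact: sub_multiples.
move=> w [a [p [b [[x Ix [_ tx]] E]]]].
by apply (mem_tips (is_tip_sandwich tx E)); apply: IM.
Qed.

Lemma tips_path_ideal (P : set (qpath Q)) :
  tips le (path_ideal P : set KQ) = multiples P.
Proof.
apply/seteqP; split=> [p [x + [_ [px _]]]|p Pp].
  by rewrite path_idealE; apply.
by apply (mem_tips (is_tip_pbasis p)); apply/pbasis_path_ideal.
Qed.

(** Division: the tip of an element x of V can be cancelled by an element w of W,
    which leaves an element of V with a smaller tip.  The order being a
    well-order, this shows that x is in W. *)
Lemma subspace_tips_sub V W :
  subspace V -> subspace W -> W `<=` V -> tips le V `<=` tips le W -> V `<=` W.
Proof.
move=> sV sW WV tVW x.
have [->|] := eqVneq x 0; first by case: sW.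
move=> /tip_exists[p]; move: p x; apply: admissible_ind => p IH x tx Vx.
have [w Ww [_ tw]] := tVW p (mem_tips tx Vx).
have [[px ubx] [pw ubw]] := (tx, tw).
pose c := x@_p / w@_p; pose y := x - c *: w.
have ex : x = c *: w + y by rewrite addrC subrK.
suff Wy : W y by rewrite ex; case: sW => _; apply.
have [->|nzy] := eqVneq y 0; first by case: sW.
have Vy : V y by apply: subspaceB => //; apply: subspaceZ => //; apply: WV.
have [q tq] := tip_exists nzy; apply: IH (tq) Vy.
have [qy _] := tq; apply/andP; split.
  apply: contraTneq qy => <-; rewrite -mcoeff_eq0 mcoeffB mcoeffZ.
  by rewrite divfK ?subrr // mcoeff_neq0.
move: qy => /(fsubsetP (msuppB_le _ _)); rewrite in_fsetU => /orP[/ubx //|].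
by move/(fsubsetP (msuppZ_le _ _))/ubw.
Qed.

Lemma ideal_nontips_eq0 I x : I x -> path_span (nontips le I) x -> x = 0.
Proof.
move=> Ix Nx; apply/eqP; apply: contraT => /tip_exists[p tx].
by case: (Nx p _) => //; [case: tx | apply (mem_tips tx)].
Qed.

(** The existence of normal forms modulo I: every path is a tip of the
    subspace of the sums of an element of I and a combination of nontips, so
    this subspace is everything. *)
Lemma nontips_repr I x :
  two_sided_ideal I -> exists2 y, I y & path_span (nontips le I) (x - y).
Proof.
move=> idI; have sI := ideal_subspace idI.
pose W : set KQ := [set x | exists2 y, I y & path_span (nontips le I) (x - y)].
have sN := path_span_subspace K (nontips le I).
have sW : subspace W.
  split=> [|c u v [u' Iu' Nu] [v' Iv' Nv]].
    by exists 0; [case: sI | rewrite subr0; case: sN].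
  exists (c *: u' + v'); first by case: sI => _; apply.
  have -> : c *: u + v - (c *: u' + v') = c *: (u - u') + (v - v').
    by rewrite scalerBr opprD addrACA.
  by case: sN => _; apply.
suff : @setT KQ `<=` W by apply.
apply: subspace_tips_sub => // p _.
have [[y Iy [_ ty]]|np] := pselect (tips le I p).
  by apply (mem_tips ty); exists y => //; rewrite subrr; case: sN.
apply (mem_tips (is_tip_pbasis p)); exists 0; first by case: sI.
by rewrite subr0 => q; rewrite msupp_pbasis => /eqP->.
Qed.

(** Let P be the minimal set of tips.  Each t in P has a normal form modulo I, so
    G contains an element of tip t; hence the ideal generated by G has all the
    tips of I, and is equal to it. *)
Lemma reduced_groebner_basis_gen I (G : set KQ) :
  two_sided_ideal I -> reduced_groebner_basis le I G -> I = ideal_gen G.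
Proof.
move=> idI [P [eP _] eG]; have idG := ideal_gen_ideal G.
have GI : ideal_gen G `<=` I.
  by apply: ideal_gen_sub => // g; rewrite eG => -[t _ []].
apply/seteqP; split=> //.
apply: subspace_tips_sub => //; try exact: ideal_subspace.
move: eP; rewrite path_ideal_inj multiples_tips // => eP.
rewrite -eP -(multiples_tips idG) => w [a [t [b [Pt E]]]].
exists a, t, b; split=> //; have tI : tips le I t by rewrite -eP; apply: sub_multiples.
have [g Ig Ng] := nontips_repr (pb t) idI.
have gt1 : t \in msupp g.
  rewrite -mcoeff_neq0; apply/eqP => g0; apply: (Ng t _ tI).
  by rewrite -mcoeff_neq0 mcoeffB mcoeff_pbasis eqxx g0 subr0 oner_eq0.
have [q tq] : exists q, is_tip le g q.
  by apply: tip_exists; apply: contraTneq gt1 => ->; rewrite msupp0.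
have eqt : q = t.
  apply: contrapT => /eqP nqt; apply: (Ng q _ (mem_tips tq Ig)).
  rewrite -mcoeff_neq0 mcoeffB mcoeff_pbasis [t == q]eq_sym (negPf nqt) sub0r oppr_eq0.
  by rewrite mcoeff_neq0; case: tq.
rewrite -eqt; apply (mem_tips tq); apply: sub_ideal_gen.
by rewrite eG; exists t.
Qed.

End Tips.

(** * Strong Koszul presentations *)

Section KoszulPresentations.
Import GRing.Theory.
Local Open Scope ring_scope.
Variables (K : fieldType) (Q : quiver) (le : rel (qpath Q)).
Hypothesis hle : length_admissible le.
Variable T : {set lpath Q 2}.
Local Notation KQ := (path_algebra K Q).
Local Notation pb := (@pbasis K Q).
Local Notation point := {ffun var_index K le T -> K}.
Implicit Types (X : point) (t s : lpath Q 2) (p q w : qpath Q).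

Local Notation Tpaths := [set val t | t in [set` T]].
Local Notation IX X := (ideal_gen (gset X)).

(** A path ideal is spanned by paths, so its tips are the paths that it contains;
    in particular the normal paths do not depend on K. *)
Lemma normal_pathsE : normal_paths K le T = ~` multiples Tpaths.
Proof. by rewrite /normal_paths /nontips tips_path_ideal. Qed.

Lemma plength_lpath n (t : lpath Q n) : plength (val t) = n.
Proof. exact/eqP/(valP t). Qed.

Lemma N2ofP t n : n \in N2of K le T t ->
  [/\ ~ multiples Tpaths (val n), n \notin T, gt le (val t) (val n),
      pstart (val n) = pstart (val t) & pend (val n) = pend (val t)].
Proof.
rewrite inE => /and4P[+ gtn /eqP es /eqP ee].
rewrite inE asboolE normal_pathsE => nn; split=> //.
by apply/negP => nT; apply: nn; apply: sub_multiples; exists n.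
Qed.

Lemma mcoeff_gelt X t p :
  (gelt X t)@_p = (val t == p)%:R
    - \sum_(c : var_index K le T | (val c).1 == t) X c * (val (val c).2 == p)%:R.
Proof.
rewrite /gelt mcoeffB mcoeff_pbasis raddf_sum /=; congr (_ - _).
by apply: eq_bigr => c _; rewrite mcoeffZ mcoeff_pbasis.
Qed.

Lemma msupp_gelt X t p : p \in msupp (gelt X t) ->
  p = val t \/ exists2 n, n \in N2of K le T t & p = val n.
Proof.
rewrite -mcoeff_neq0 mcoeff_gelt => nz.
have [<-|ntp] := eqVneq (val t) p; first by left.
right; apply: contrapT => none; move: nz; rewrite (negPf ntp) sub0r oppr_eq0.
rewrite big1 ?eqxx // => c /eqP ec.
have [ep|_] := eqVneq (val (val c).2) p; last by rewrite mulr0.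
by case: none; exists (val c).2 => //; have /andP[_] := valP c; rewrite ec.
Qed.

(** Among the paths in T, only t occurs in g_t.  This is why the coefficients of
    a combination of the g_t can be read off at the paths in T. *)
Lemma mcoeff_gelt_T X t s : s \in T -> (gelt X t)@_(val s) = (t == s)%:R.
Proof.
move=> sT; rewrite mcoeff_gelt big1 ?subr0 ?(inj_eq val_inj) // => c _.
have [/val_inj es|_] := eqVneq (val (val c).2) (val s); last by rewrite mulr0.
by have /andP[_ /N2ofP[_]] := valP c; rewrite es sT.
Qed.

Lemma gelt_neq0 X t : t \in T -> gelt X t != 0.
Proof.
move=> tT; apply/eqP => g0; have := mcoeff_gelt_T X t tT.
by rewrite g0 mcoeff0 eqxx => /eqP; rewrite eq_sym oner_eq0.
Qed.

Lemma is_tip_gelt X t : t \in T -> is_tip le (gelt X t) (val t).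
Proof.
move=> tT; split=> [|q /msupp_gelt[->|[n /N2ofP[_ _ /andP[_ le_nt] _ _] ->]] //].
  by rewrite -mcoeff_neq0 mcoeff_gelt_T // eqxx oner_eq0.
by have [[[le_refl _] _] _] := admissible_total_order hle.
Qed.

Lemma gelt_parallel X t p : p \in msupp (gelt X t) ->
  [/\ plength p = 2%N, pstart p = pstart (val t) & pend p = pend (val t)].
Proof.
move=> /msupp_gelt[->|[n /N2ofP[_ _ _ es ee] ->]]; split=> //.
  exact/eqP/(valP t).
exact/eqP/(valP n).
Qed.

(** The terms of g_t are parallel paths, which makes g_t uniform. *)
Lemma gelt_vertices X t :
  pb (pvertex (pstart (val t))) * gelt X t * pb (pvertex (pend (val t)))
    = gelt X t.
Proof.
set v := pstart _; set w := pend _; apply/malgP => p.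
have [pg|np] := boolP (p \in msupp (gelt X t)).
  have [_ es ee] := gelt_parallel pg.
  by apply: mcoeff_sandwich; rewrite /v /w -es -ee sandwich_vertices.
rewrite [RHS]mcoeff_outdom //; apply: mcoeff_outdom; apply: contra np.
move=> /msupp_sandwich[q qg E]; have [_ es ee] := gelt_parallel qg.
by move: E; rewrite /v /w -es -ee sandwich_vertices => -[<-].
Qed.

Lemma gelt_IX X t : t \in T -> IX X (gelt X t).
Proof. by move=> tT; apply: sub_ideal_gen; exists t. Qed.

Lemma multiples_sub_tips X : multiples Tpaths `<=` tips le (IX X).
Proof.
rewrite -(multiples_tips hle (ideal_gen_ideal (gset X))).
move=> w [a [_ [b [[t tT <-] E]]]]; exists a, (val t), b; split=> //.
by apply (mem_tips (is_tip_gelt X tT)); apply: gelt_IX.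
Qed.

(** The degree 2 part of I(X) is spanned by the g_t: a product a g_t b with terms
    of length 2 is g_t itself.  The coefficients of the combination are given
    explicitly, which turns the claim into a linear condition on x. *)
Lemma mcoeff_IX2 X x p : IX X x -> plength p = 2%N ->
  x@_p = \sum_(t in T) x@_(val t) * (gelt X t)@_p.
Proof.
move=> + p2; apply: (@ideal_gen_ind K Q (gset X)
  [set x | x@_p = \sum_(t in T) x@_(val t) * (gelt X t)@_p]) => [|a g b].
  split=> [|c u v /= Eu Ev].
    by rewrite /= mcoeff0 big1 // => t _; rewrite mcoeff0 mul0r.
  rewrite mcoeffD mcoeffZ Eu Ev mulr_sumr -big_split /=.
  by apply: eq_bigr => t _; rewrite [(c *: u + v)@__]mcoeffD mcoeffZ mulrDl mulrA.
case=> s sT <- /=; set y := _ * _ * _.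
have [y0|[[p0 p0y] l2]] : (forall q : qpath Q, plength q = 2%N -> y@_q = 0) \/
    (exists p0, p0 \in msupp y) /\ plength a = 0%N /\ plength b = 0%N.
- have [[q [q2 yq]]|none] :=
    pselect (exists q, plength q = 2%N /\ y@_q != 0); last first.
    left=> q q2; apply/eqP; apply: contraT => yq.
    by case: none; exists q.
  right; move: yq; rewrite mcoeff_neq0 => qy; split; first by exists q.
  have [r /gelt_parallel[r2 _ _] /sandwich_length] := msupp_sandwich qy.
  rewrite q2 r2 addnAC => /eqP; rewrite -[X in X == _]add0n eqn_add2r eq_sym.
  by rewrite addn_eq0 => /andP[/eqP-> /eqP->].
- rewrite y0 // big1 // => t _; rewrite y0 ?mul0r //.
  exact/eqP/(valP t).
suff -> : y = gelt X s.
  rewrite (bigD1 s) //= mcoeff_gelt_T // eqxx mul1r big1 ?addr0 // => t /andP[tT nts].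
  by rewrite mcoeff_gelt_T // eq_sym (negPf nts) mul0r.
have [q qs /sandwichP[eaq eqb _]] := msupp_sandwich p0y.
have vertexE (c : qpath Q) :
    plength c = 0%N -> c = pvertex (pstart c) /\ pend c = pstart c.
  move=> /size0nil c0; split; last by rewrite /pend c0.
  exact: qpath_eq.
have [a0 b0] := l2; have [ea ea'] := vertexE a a0; have [eb eb'] := vertexE b b0.
have [_ es ee] := gelt_parallel qs.
rewrite /y ea eb -eqb ee -ea' eaq es; exact: gelt_vertices.
Qed.

(** Suppose that t is not in T.  As x is a combination of the g_s, its tip t is
    then a lower term of some g_s, where s occurs in x.  So s is larger than the
    tip of x, which is absurd. *)
Lemma quadratic_tips_T X x t : IX X x -> quadratic x -> is_tip le x (val t) ->
  t \in T.
Proof.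
move=> Ix x2 [tx ubt]; apply: contraT => ntT.
have t2 : plength (val t) = 2%N by apply/eqP/(valP t).
move: (tx); rewrite -mcoeff_neq0 (mcoeff_IX2 Ix t2) big1 ?eqxx // => s sT.
have [->|xs] := eqVneq x@_(val s) 0; first by rewrite mul0r.
have [->|] := eqVneq (gelt X s)@_(val t) 0; first by rewrite mulr0.
rewrite mcoeff_neq0 => /msupp_gelt[/val_inj ets|[n nN /val_inj etn]].
  by rewrite ets sT in ntT.
have /N2ofP[_ _ /andP[neq le_ns] _ _] := nN.
have le_st : le (val s) (val t) by apply: ubt; rewrite -mcoeff_neq0.
have [[_ le_anti] _] := admissible_total_order hle.
by case/eqP: neq; apply: le_anti; rewrite {1}etn in le_st; rewrite le_st.
Qed.

(** From left to right, all tips of the ideal are multiples of tips of quadratic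
    elements.  From right to left, the g_t themselves form a quadratic Groebner
    basis. *)
Lemma strong_koszul_tipsP X :
  strong_koszul le (IX X) <-> tips le (IX X) `<=` multiples Tpaths.
Proof.
have idI := ideal_gen_ideal (gset X).
split=> [[G [_ GI _ eG] G2]|tT].
  move: eG; rewrite path_ideal_inj (multiples_tips hle idI) => <-.
  move=> w [a [p [b [[x Gx [_ tx]] E]]]].
  have px : p \in msupp x by case: tx.
  have p2 : plength p == 2%N by apply/eqP; apply: (G2 x Gx).
  exists a, p, b; split=> //; exists (Sub p p2 : lpath Q 2); last exact: SubK.
  by apply: (quadratic_tips_T (GI x Gx) (G2 x Gx)); rewrite SubK.
have quad : gset X `<=` @quadratic K Q.
  by move=> _ [t _ <-] p /gelt_parallel[].
exists (gset X) => //; split=> //.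
- by split=> //; exists (gset X) => // g /quad; exists 2%N.
- exact: sub_ideal_gen.
- move=> g gX; split; first by exists 2%N; apply: quad.
  case: gX => t tX <-; split; first exact: gelt_neq0.
  by exists (pstart (val t)), (pend (val t)); rewrite gelt_vertices.
apply/path_ideal_inj; rewrite (multiples_tips hle idI).
apply/seteqP; split=> w.
  rewrite -[X in _ -> X w](multiples_tips hle idI).
  move=> [a [p [b [[x gx tx] E]]]]; exists a, p, b; split=> //.
  by exists x => //; apply: sub_ideal_gen.
move=> /tT[a [_ [b [[t tX <-] E]]]]; exists a, (val t), b; split=> //.
by apply (mem_tips (is_tip_gelt X tX)); exists t.
Qed.

Lemma GrAlg_tipsP X : GrAlg X <-> tips le (IX X) = multiples Tpaths.
Proof.
split=> [/strong_koszul_tipsP tT|tT].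
  by apply/seteqP; split=> //; apply: multiples_sub_tips.
by apply/strong_koszul_tipsP; rewrite tT.
Qed.

(** T is minimal because its paths all have length 2.  That an element g of the
    ideal with t - g a combination of nontips must be g_t holds because no
    nonzero element of an ideal is a combination of its nontips. *)
Lemma GrAlg_reduced_groebner_basis X :
  GrAlg X -> reduced_groebner_basis le (IX X) (gset X).
Proof.
move=> /GrAlg_tipsP tT; have idI := ideal_gen_ideal (gset X).
have sI := ideal_subspace idI.
have normal_gelt t : path_span (nontips le (IX X)) (pb (val t) - gelt X t).
  rewrite opprB addrCA subrr addr0.
  apply: subspace_sum => [|c _]; first exact: path_span_subspace.
  apply (subspaceZ (X c) (path_span_subspace K (nontips le (IX X)))).
  move=> q; rewrite msupp_pbasis => /eqP-> tip.
  by have /andP[_ /N2ofP[+ _ _ _ _]] := valP c; rewrite -tT.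
exists Tpaths; first split.
- by apply/path_ideal_inj; rewrite (multiples_tips hle idI).
- move=> P' sP'; rewrite path_ideal_inj (multiples_tips hle idI) tT => eP'.
  apply/seteqP; split=> // p Tp.
  have len2 q : Tpaths q -> plength q = 2%N by case=> t _ <-; apply/eqP/(valP t).
  have P'p : multiples P' p by rewrite eP'; apply: sub_multiples.
  by apply: multiples_lpath (len2 p Tp) P'p => q /sP'/len2.
apply/seteqP; split=> [_ [t tX <-]|g [_ [t tX <-] [Ig Ng]]].
  by exists (val t); [exists t | split; [apply: gelt_IX | ]].
exists t => //; apply/eqP; rewrite eq_sym -subr_eq0; apply/eqP.
apply: (ideal_nontips_eq0 hle (I := IX X)).
  by apply (subspaceB sI Ig); apply: gelt_IX.
have -> : g - gelt X t = (pb (val t) - gelt X t) - (pb (val t) - g).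
  by rewrite [- (pb (val t) - g)]opprB [RHS]addrC subrKA.
exact: (subspaceB (path_span_subspace K (nontips le (IX X)))).
Qed.

Lemma GrAlg_psiE (r : {set var_index K le T})
    (psi : {c : var_index K le T | c \in r} -> K) :
  GrAlg_psi psi = @GrAlg K Q le T `&` [set X | forall c, X (val c) = psi c].
Proof.
apply/seteqP; split=> [X [I [skI rI psiX]]|X [GX psiX]].
  split=> //; rewrite /GrAlg /=.
  have [G [[idI _] _ _ _] _] := skI.
  by rewrite -(reduced_groebner_basis_gen hle idI rI).
by exists (IX X); split=> //; apply: GrAlg_reduced_groebner_basis.
Qed.

End KoszulPresentations.

(** * Coordinates in a fixed degree *)

Section HomogeneousPart.
Import GRing.Theory.
Local Open Scope ring_scope.
Variables (K : fieldType) (Q : quiver) (n : nat).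
Local Notation KQ := (path_algebra K Q).
Local Notation pb := (@pbasis K Q).
Local Notation row_of_degree := 'rV[K]_#|{: lpath Q n}|.
Implicit Types (x y : KQ) (v : row_of_degree) (j : 'I_#|{: lpath Q n}|).

Definition coordinate_path j : qpath Q := val (enum_val j).

Definition degree_row x : row_of_degree := \row_j x@_(coordinate_path j).

Definition degree_elt v : KQ := \sum_j v 0 j *: pb (coordinate_path j).

Lemma coordinate_path_inj : injective coordinate_path.
Proof. by move=> i j e; apply: enum_val_inj; apply: val_inj. Qed.

Lemma coordinate_pathP p : plength p = n -> exists j, p = coordinate_path j.
Proof.
move/eqP => np; exists (enum_rank (Sub p np : lpath Q n)).
by rewrite /coordinate_path enum_rankK SubK.
Qed.

Lemma plength_coordinate_path j : plength (coordinate_path j) = n.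
Proof. exact: plength_lpath. Qed.

Lemma degree_row_linear c x y :
  degree_row (c *: x + y) = c *: degree_row x + degree_row y.
Proof. by apply/rowP => j; rewrite !mxE mcoeffD mcoeffZ. Qed.

Lemma degree_row0 : degree_row 0 = 0.
Proof. by apply/rowP => j; rewrite !mxE mcoeff0. Qed.

Lemma degree_eltK : cancel degree_elt degree_row.
Proof.
move=> v; apply/rowP => j; rewrite mxE raddf_sum (bigD1 j) //= big1 => [|i nij].
  by rewrite addr0 mcoeffZ mcoeff_pbasis eqxx mulr1.
by rewrite mcoeffZ mcoeff_pbasis (inj_eq coordinate_path_inj) (negPf nij) mulr0.
Qed.

Lemma degree_elt_linear c (u v : row_of_degree) :
  degree_elt (c *: u + v) = c *: degree_elt u + degree_elt v.
Proof.
rewrite scaler_sumr -big_split; apply: eq_bigr => j _ /=.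
by rewrite !mxE scalerDl scalerA.
Qed.

Lemma degree_elt0 : degree_elt 0 = 0.
Proof. by apply: big1 => j _; rewrite mxE scale0r. Qed.

Lemma msupp_degree_elt v p :
  p \in msupp (degree_elt v) -> exists2 j, p = coordinate_path j & v 0 j != 0.
Proof.
rewrite -mcoeff_neq0 => nz; apply: contrapT => none; case/eqP: nz.
rewrite raddf_sum big1 //= => j _; rewrite mcoeffZ mcoeff_pbasis.
have [ep|_] := eqVneq (coordinate_path j) p; last by rewrite mulr0.
have [->|vj] := eqVneq (v 0 j) 0; first by rewrite mul0r.
by case: none; exists j.
Qed.

(** The element attached to the degree n row of a homogeneous x is thus x or 0:
    this is how the rows of the matrix below are traced back to elements of the
    ideal. *)
Lemma degree_rowK m x : path_span [set p | plength p = m] x ->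
  degree_elt (degree_row x) = if m == n then x else 0.
Proof.
move=> xm; case: eqP => [emn|nmn].
  apply/malgP => p; have [np|nnp] := eqVneq (plength p) n.
    have [j ->] := coordinate_pathP np.
    by have /rowP/(_ j) := degree_eltK (degree_row x); rewrite !mxE.
  rewrite [RHS]mcoeff_outdom; last first.
    by apply: contraNN nnp => /xm ->; rewrite emn.
  apply: mcoeff_outdom; apply: contraNN nnp => /msupp_degree_elt[j -> _].
  by rewrite plength_coordinate_path.
have -> : degree_row x = 0; last exact: degree_elt0.
apply/rowP => j; rewrite !mxE; apply: mcoeff_outdom; apply/negP => /xm /= jm.
by case: nmn; rewrite -jm plength_coordinate_path.
Qed.

End HomogeneousPart.

(** * GrAlg(T) as a rank condition *)

Section RankCondition.
Import GRing.Theory.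
Local Open Scope ring_scope.
Variables (K : fieldType) (Q : quiver) (le : rel (qpath Q)).
Hypothesis hle : length_admissible le.
Variable T : {set lpath Q 2}.
Local Notation KQ := (path_algebra K Q).
Local Notation pb := (@pbasis K Q).
Local Notation point := {ffun var_index K le T -> K}.
Local Notation Tpaths := [set val t | t in [set` T]].
Local Notation IX X := (ideal_gen (gset X)).
Implicit Types (X : point) (n : nat).

Definition short_path n : finType := {i : 'I_n.+1 & lpath Q i}.

(** Every pair of paths of length at most n is allowed, so that no condition ties
    the factors together: the products whose terms do not have length n only
    contribute zero rows. *)
Definition generator_index n : finType :=
  (short_path n * {t : lpath Q 2 | t \in T} * short_path n)%type.

Definition generator n X (e : generator_index n) : KQ :=
  pb (val (tagged e.1.1)) * gelt X (val e.1.2) * pb (val (tagged e.2)).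

Definition generator_mx n X : 'M[K]_(#|generator_index n|, #|{: lpath Q n}|) :=
  \matrix_(i < #|generator_index n|) degree_row n (generator X (enum_val i)).

(** The entry at the path w is the coefficient in g_t of the path obtained by
    cancelling the outer factors in w, or 0 if they cannot be cancelled. *)
Lemma poly_fun_generator_mx n i j : poly_fun (fun X => generator_mx n X i j).
Proof.
have pgelt t p : poly_fun (fun X => (gelt X t)@_p).
  have [f Ef] : poly_fun (fun X : point => (val t == p)%:R +
      - \sum_(c : var_index K le T | (val c).1 == t)
          X c * (val (val c).2 == p)%:R).
    apply: poly_funD; first exact: poly_fun_const.
    apply: poly_funN; apply: poly_fun_sum => c.
    by apply: poly_funM; [apply: poly_fun_coord | apply: poly_fun_const].
  by exists f => X; rewrite mcoeff_gelt Ef.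
pose e := enum_val i; pose w := coordinate_path j.
have eM X : generator_mx n X i j = (generator X e)@_w by rewrite !mxE.
pose a := val (tagged e.1.1); pose b := val (tagged e.2).
have [[p E]|none] := pselect (exists p, sandwich a p b = Some w).
  have [f Ef] := pgelt (val e.1.2) p.
  by exists f => X; rewrite eM (mcoeff_sandwich _ E) Ef.
have [f Ef] := poly_fun_const (var_index K le T) (0 : K).
exists f => X; rewrite -Ef eM; apply: mcoeff_outdom; apply/negP.
by move=> /msupp_sandwich[p _ E]; apply: none; exists p.
Qed.

(** Together with the next lemma, this says that the row space of the matrix is
    the degree n part of I(X). *)
Lemma generator_mx_sub n X x :
  IX X x -> (degree_row n x <= generator_mx n X)%MS.
Proof.
apply: (@ideal_gen_ind K Q (gset X)
  [set x | (degree_row n x <= generator_mx n X)%MS]) => [|a _ b [t tT <-]] /=.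
  split=> [|c x' y' /= xM yM]; first by rewrite /= degree_row0 sub0mx.
  by rewrite degree_row_linear addmx_sub ?scalemx_sub.
have [ab|long] := boolP ((plength a < n.+1) && (plength b < n.+1))%N; last first.
  have -> : degree_row n (pb a * gelt X t * pb b) = 0; last exact: sub0mx.
  apply/rowP => j; rewrite !mxE; apply: mcoeff_outdom; apply: contraNN long.
  move=> /msupp_sandwich[p _ /sandwich_length]; rewrite plength_coordinate_path => ->.
  by rewrite !ltnS leq_addl -addnA leq_addr.
have [la lb] := andP ab.
pose e : generator_index n :=
  (Tagged (fun i : 'I_n.+1 => lpath Q i)
     (exist _ a (eqxx _) : lpath Q (Ordinal la)),
   exist _ t tT,
   Tagged (fun i : 'I_n.+1 => lpath Q i)
     (exist _ b (eqxx _) : lpath Q (Ordinal lb))).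
have -> : pb a * gelt X t * pb b = generator X e by [].
have -> : degree_row n (generator X e) = row (enum_rank e) (generator_mx n X).
  by rewrite rowK enum_rankK.
exact: row_sub.
Qed.

Lemma degree_elt_IX n X (v : 'rV[K]_#|{: lpath Q n}|) :
  (v <= generator_mx n X)%MS -> IX X (degree_elt v).
Proof.
have idI := ideal_gen_ideal (gset X); have sI := ideal_subspace idI.
case/submxP => u ->; rewrite mulmx_sum_row.
apply: (big_ind (fun v => IX X (degree_elt v))) => [|v1 v2 I1 I2|i _].
- by rewrite degree_elt0; case: sI.
- by rewrite -[v1]scale1r degree_elt_linear; case: sI => _; apply.
rewrite -[_ *: _]addr0 degree_elt_linear degree_elt0 addr0.
apply (subspaceZ (u 0 i) sI); rewrite rowK; set e := enum_val i.
have len : path_span [set p | plength p =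
    (plength (val (tagged e.1.1)) + 2 + plength (val (tagged e.2)))%N]
    (generator X e).
  move=> w /msupp_sandwich[p pg E]; have [p2 _ _] := gelt_parallel hle pg.
  by rewrite /= (sandwich_length E) p2.
rewrite (degree_rowK n len); case: ifP => _; last by case: sI.
have [_ _ IM] := idI; apply: IM; apply: gelt_IX; exact: (valP e.1.2).
Qed.

Lemma rank_generator_mx n X :
  \rank (generator_mx n X) =
  #|[pred j : 'I_#|{: lpath Q n}| | `[< tips le (IX X) (coordinate_path j) >]]|.
Proof.
have [[[le_refl le_trans] le_anti] le_tot] := admissible_total_order hle.
pose le_n : rel 'I_#|{: lpath Q n}| := relpre (@coordinate_path Q n) le.
have le_n_total : total_order le_n.
  split; last by move=> i j; apply: le_tot.
  split; last by move=> i j /le_anti /coordinate_path_inj.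
  by split=> [i|j i k]; [apply: le_refl | apply: le_trans].
rewrite (rank_leads _ le_n_total); apply: eq_card => j; rewrite !inE.
apply: asbool_equiv_eq; split.
  move=> [v vM [vj ubv]].
  have tv : is_tip le (degree_elt v) (coordinate_path j).
    split=> [|p /msupp_degree_elt[k -> vk]]; last exact: ubv.
    by rewrite -mcoeff_neq0; move: vj; rewrite -{1}[v]degree_eltK mxE.
  by apply (mem_tips tv); apply: degree_elt_IX.
move=> [x Ix [_ [xj ubx]]]; exists (degree_row n x); first exact: generator_mx_sub.
by split=> [|k]; rewrite mxE mcoeff_neq0 //; apply: ubx.
Qed.

Definition reducible_count n : nat :=
  #|[pred j : 'I_#|{: lpath Q n}| |
      `[< multiples Tpaths (coordinate_path j) >]]|.

(** Every path with a subpath in T is a tip of I(X), so an upper bound on the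
    number of tips of length n leaves no room for other tips. *)
Lemma GrAlg_rankP X :
  GrAlg X <-> forall n, (\rank (generator_mx n X) <= reducible_count n)%N.
Proof.
split=> [/(GrAlg_tipsP hle) tT n|rX]; first by rewrite rank_generator_mx tT.
apply/(GrAlg_tipsP hle); apply/seteqP; split=> [p tp|]; last first.
  exact: (multiples_sub_tips hle).
have [j ej] := coordinate_pathP (erefl (plength p)).
have := rX (plength p); rewrite rank_generator_mx leqNgt => /negP nlt.
apply: contrapT => np; apply: nlt; apply: proper_card; apply/properP; split.
  apply/fintype.subsetP => k; rewrite !inE; exact: (multiples_sub_tips hle).
by exists j; rewrite unfold_in /= -ej; [exact/asboolP | exact/asboolPn].
Qed.

Lemma affine_variety_GrAlg : affine_variety (@GrAlg K Q le T).
Proof.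
apply/affine_varietyP.
exists [set F | exists n k
    (f : 'I_k -> 'I_#|generator_index n|) (g : 'I_k -> 'I_#|{: lpath Q n}|),
  (reducible_count n < k)%N /\ F = fun X => \det (mxsub f g (generator_mx n X))].
split=> [_ [n [k [f [g [_ ->]]]]]|X].
  apply: poly_fun_det => i j.
  have [h Eh] := poly_fun_generator_mx (f i) (g j).
  by exists h => X; rewrite mxE Eh.
split=> [/GrAlg_rankP rX _ [n [k [f [g [ltk ->]]]]]|SX].
  exact: (rank_le_minors _ _).1 (rX n) k f g ltk.
apply/GrAlg_rankP => n; apply/rank_le_minors => k f g ltk.
by apply: (SX (fun X => \det (mxsub f g (generator_mx n X)))); exists n, k, f, g.
Qed.

End RankCondition.

(** * Fixing and forgetting coordinates *)

Section FixedCoordinates.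
Import GRing.Theory.
Local Open Scope ring_scope.
Variables (K : fieldType) (Q : quiver) (le : rel (qpath Q)).
Variables (T : {set lpath Q 2}) (r : {set var_index K le T}).
Variable psi : {c : var_index K le T | c \in r} -> K.

(** The right inverse of the projection that forgets the coordinates in r, whose
    image is the set of points with coordinates psi on r.  One of the two partial
    projections is defined at each c, so the default value 0 is never taken. *)
Definition fill (Z : {ffun free_index r -> K}) : {ffun var_index K le T -> K} :=
  [ffun c => oapp psi (oapp Z 0 (insub c)) (insub c)].

Lemma fill_fixed Z (c : {c : var_index K le T | c \in r}) :
  fill Z (val c) = psi c.
Proof. by rewrite ffunE valK. Qed.

Lemma fill_free Z (c : free_index r) : fill Z (val c) = Z c.
Proof. by rewrite ffunE valK insubN ?(valP c). Qed.

Lemma fillK Z : forget r (fill Z) = Z.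
Proof. by apply/ffunP => c; rewrite ffunE fill_free. Qed.

Lemma forgetK (X : {ffun var_index K le T -> K}) :
  (forall c : {c : var_index K le T | c \in r}, X (val c) = psi c) ->
  fill (forget r X) = X.
Proof.
move=> Xpsi; apply/ffunP => c; have [rc|nrc] := boolP (c \in r).
  by rewrite -[c](SubK {c : var_index K le T | c \in r} rc) fill_fixed Xpsi.
by rewrite -[c](SubK (free_index r) nrc) fill_free ffunE.
Qed.

Lemma poly_fun_fill c : poly_fun (fun Z => fill Z c).
Proof.
have [rc|nrc] := boolP (c \in r).
  have [f Ef] := poly_fun_const (free_index r) (psi (Sub c rc)).
  by exists f => Z; rewrite -Ef -(fill_fixed Z) SubK.
have [f Ef] := poly_fun_coord K (Sub c nrc : free_index r).
by exists f => Z; rewrite -Ef -fill_free SubK.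
Qed.

Lemma card_free_index : #|free_index r| = (\sum_(t in T) #|N2of K le T t| - #|r|)%N.
Proof.
by rewrite card_sig -card_var_index -(cardC (mem r)) addKn; apply: eq_card.
Qed.

Lemma affine_variety_fixed :
  affine_variety [set X : {ffun var_index K le T -> K} | forall c, X (val c) = psi c].
Proof.
apply/affine_varietyP; exists [set F : {ffun var_index K le T -> K} -> K |
  exists c, F = fun X => X (val c) - psi c].
split=> [_ [c ->]|X].
  apply: poly_funD; first exact: poly_fun_coord.
  exact: poly_fun_const.
split=> [Xpsi _ [c ->]|SX c]; first by rewrite Xpsi subrr.
apply/eqP; rewrite -subr_eq0; apply/eqP.
by apply: (SX (fun X => X (val c) - psi c)); exists c.
Qed.

End FixedCoordinates.

Theorem theorem6p2 (K : fieldType) (Q : quiver) (le : rel (qpath Q))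
    (hle : length_admissible le) (T : {set lpath Q 2})
    (r : {set var_index K le T}) (psi : {c : var_index K le T | c \in r} -> K) :
  [/\ subvariety (GrAlg_psi psi) (@GrAlg K Q le T),
      forall X, GrAlg_psi psi X ->
        forall c : {c : var_index K le T | c \in r}, X (val c) = psi c,
      #|free_index r| = (\sum_(t in T) #|N2of K le T t| - #|r|)%N
    & affine_variety (forget r @` GrAlg_psi psi)].
Proof.
have GrAlg_variety := affine_variety_GrAlg K hle T.
rewrite (GrAlg_psiE hle psi); split.
- split; [exact: GrAlg_variety | | by move=> X []].
  exact: affine_varietyI GrAlg_variety (affine_variety_fixed psi).
- by move=> X [].
- exact: card_free_index.
suff -> : forget r @` (@GrAlg K Q le T `&` [set X | forall c, X (val c) = psi c]) =
    fill psi @^-1` (@GrAlg K Q le T).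
  by apply: affine_variety_preimage => // c; apply: poly_fun_fill.
apply/seteqP; split=> [_ [X [GX Xpsi] <-]|Z GZ] /=; first by rewrite forgetK.
exists (fill psi Z); last exact: fillK.
by split=> // c; apply: fill_fixed.
Qed.
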